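(* Let $(n_i)_{i\geq 1}$ be a sequence of integers with $n_i>1$ for all $i$. For each $n\geq 1$ let $\mathcal{C}_n=\bigoplus_{i\leq n}\mathbb{Z}_{n_i}$ (a finite discrete group), and let $\mathcal{C}=\varprojlim_n \mathcal{C}_n$ be the projective limit, as a topological group, along the projections $\pi_{m,n}\colon \mathcal{C}_m\to\mathcal{C}_n$ onto the first $n$ factors ($n\leq m$). Then $\mathcal{C}$ admits a total order relative to which it is a complete bialgebraic lattice whose Lawson topology is the given topology of $\mathcal{C}$.
   Context: $\mathbb{Z}_{k}$ denotes the cyclic group of order $k$. In a poset $P$, for $x\in P$ write $\uparrow x=\{y\in P\mid x\leq y\}$, $\downarrow x=\{y\in P\mid y\leq x\}$, and for $F\subseteq P$ write $\uparrow F=\bigcup_{x\in F}\uparrow x$. In a directed complete poset $P$, $x\ll y$ means: for every directed $S\subseteq P$ with $y\leq\sup S$ there is $s\in S$ with $x\leq s$. An element $k$ is compact if $k\ll k$, and $KP$ denotes the set of compact elements. $P$ is algebraic if for every $y\in P$ the set $\downarrow y\cap KP$ is directed with supremum $y$. A lattice $L$ is bialgebraic if both $L$ and its opposite $L^{op}$ are algebraic lattices. A set $U\subseteq P$ is Scott open if $U=\uparrow U$ and, for every directed $S\subseteq P$, $\sup S\in U$ implies $S\cap U\neq\emptyset$. The Lawson topology on $P$ has as a basis the sets $U\setminus \uparrow F$ with $U$ Scott open and $F\subseteq P$ finite. *)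

(* Defs.v *)
From HB Require Import structures.
From mathcomp Require Import all_boot all_order all_algebra.
From mathcomp Require Import mathcomp_extra boolp classical_sets functions cardinality filter.
From mathcomp Require Import topology tvs.

Set Implicit Arguments.
Unset Strict Implicit.
Unset Printing Implicit Defensive.

Import Order.TTheory GRing.Theory.
Local Open Scope classical_set_scope.

(* Suprema are handled through the library's set [supremums S] of least upper
   bounds of [S], so that no default value is needed when a supremum does not
   exist; the notions below are meant for directed complete posets. *)

Section Domains.
Context {d : Order.disp_t} {T : porderType d}.
Implicit Types (x y : T) (S F U W : set T).
Local Open Scope order_scope.

(* Directed sets are nonempty. *)
Definition directed S : Prop :=
  S !=set0 /\ forall x y, S x -> S y -> exists2 z, S z & x <= z /\ y <= z.

Definition way_below x y : Prop :=
  forall S s, directed S -> supremums S s -> y <= s -> exists2 t, S t & x <= t.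

Definition compact_elt : set T := [set k | way_below k k].

Definition upset F : set T := \bigcup_(x in F) [set y | x <= y].

Definition downset1 y : set T := [set x | x <= y].

Definition algebraic : Prop := forall y,
  directed (downset1 y `&` compact_elt) /\
  supremums (downset1 y `&` compact_elt) y.

Definition complete_lattice : Prop :=
  forall S, supremums S !=set0 /\ infimums S !=set0.

Definition algebraic_lattice : Prop := complete_lattice /\ algebraic.

Definition scott_open U : Prop :=
  U = upset U /\
  forall S s, directed S -> supremums S s -> U s -> (S `&` U) !=set0.

Definition lawson_basis : set (set T) :=
  [set W | exists U F, [/\ scott_open U, finite_set F & W = U `\` upset F]].

Definition lawson_open : set (set T) :=
  [set \bigcup_(W in B) W | B in [set B | B `<=` lawson_basis]].

End Domains.

Arguments algebraic {d} T.
Arguments complete_lattice {d} T.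
Arguments algebraic_lattice {d} T.
Arguments lawson_basis {d} T.
Arguments lawson_open {d} T.

(* [L^d] is [L] with the opposite order. *)
Definition bialgebraic {d : Order.disp_t} (L : porderType d) : Prop :=
  algebraic_lattice L /\ algebraic_lattice L^d.

Local Open Scope ring_scope.

Section ProductGroup.
Context {I : Type} (V : I -> zmodType).
Implicit Types x y z : prod_topology V.

Let zero : prod_topology V := fun i => 0.
Let opp x : prod_topology V := fun i => - x i.
Let add x y : prod_topology V := fun i => x i + y i.

Let addA : associative add.
Proof. by move=> x y z; apply: functional_extensionality_dep => i; exact: addrA. Qed.
Let addC : commutative add.
Proof. by move=> x y; apply: functional_extensionality_dep => i; exact: addrC. Qed.
Let add0 : left_id zero add.
Proof. by move=> x; apply: functional_extensionality_dep => i; exact: add0r. Qed.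
Let addN : left_inverse zero opp add.
Proof. by move=> x; apply: functional_extensionality_dep => i; exact: addNr. Qed.

HB.instance Definition _ :=
  GRing.isZmodule.Build (prod_topology V) addA addC add0 addN.

End ProductGroup.

(* Indices are shifted by one: [k i] is the order of the cyclic factor number
   [i + 1], and [cyc_sum k n] is the direct sum of the first [n + 1] factors,
   so [n] ranging over [nat] enumerates the sums of at least one factor.
   Since ['Z_m] is the ring of integers modulo [m] only for [1 < m], these
   definitions are meaningful when [1 < k i] for all [i]. *)

Definition cyc_sum (k : nat -> nat) (n : nat) : Type :=
  {dffun forall i : 'I_n.+1, 'Z_(k i)}.

Section CycSum.
Variables (k : nat -> nat) (n : nat).

HB.instance Definition _ := Finite.on (cyc_sum k n).

Implicit Types x y z : cyc_sum k n.

Let zero : cyc_sum k n := [ffun i => 0].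
Let opp x : cyc_sum k n := [ffun i => - x i].
Let add x y : cyc_sum k n := [ffun i => x i + y i].

Let addA : associative add.
Proof. by move=> x y z; apply/ffunP => i; rewrite !ffunE addrA. Qed.
Let addC : commutative add.
Proof. by move=> x y; apply/ffunP => i; rewrite !ffunE addrC. Qed.
Let add0 : left_id zero add.
Proof. by move=> x; apply/ffunP => i; rewrite !ffunE add0r. Qed.
Let addN : left_inverse zero opp add.
Proof. by move=> x; apply/ffunP => i; rewrite !ffunE addNr. Qed.

HB.instance Definition _ :=
  GRing.isZmodule.Build (cyc_sum k n) addA addC add0 addN.

HB.instance Definition _ := hasNbhs.Build (cyc_sum k n) principal_filter.
HB.instance Definition _ := Discrete_ofNbhs.Build (cyc_sum k n) erefl.

Let sub_cont : continuous (fun x : cyc_sum k n * cyc_sum k n => x.1 - x.2).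
Proof.
move=> x U /principal_filterP Ux; exists ([set x.1], [set x.2]) => /=.
  by split; exact: discrete_set1.
by move=> [a b] /= [-> ->].
Qed.

HB.instance Definition _ :=
  PreTopologicalNmodule_isTopologicalZmodule.Build (cyc_sum k n) sub_cont.

End CycSum.

Section Limit.
Variable k : nat -> nat.

Definition cyc_proj (n m : nat) (le_nm : (n <= m)%N) (x : cyc_sum k m) :
    cyc_sum k n :=
  [ffun i : 'I_n.+1 => x (@widen_ord n.+1 m.+1 le_nm i)].

Let cyc_proj_additive n m (le_nm : (n <= m)%N) : zmod_morphism (cyc_proj le_nm).
Proof. by move=> x y; apply/ffunP => i; rewrite !ffunE. Qed.

HB.instance Definition _ n m (le_nm : (n <= m)%N) :=
  GRing.isZmodMorphism.Build (cyc_sum k m) (cyc_sum k n) (cyc_proj le_nm)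
    (cyc_proj_additive le_nm).

Definition threads : set (prod_topology (fun n => cyc_sum k n)) :=
  [set x | forall n m (le_nm : (n <= m)%N), cyc_proj le_nm (x m) = x n].

(* As a topological group, the inverse limit carries the structure induced by
   the product of the discrete groups [cyc_sum k n]. *)
Definition cyc_lim : Type := set_type threads.

HB.instance Definition _ := SubChoice.on cyc_lim.
HB.instance Definition _ := Topological.copy cyc_lim (set_type threads).

Let threads_zmod_closed : zmod_closed (fun x => x \in threads).
Proof.
split=> [|x y /set_mem xT /set_mem yT]; apply/mem_set => n m le_nm.
  exact: raddf0.
by rewrite (raddfB (cyc_proj le_nm)) /= xT yT.
Qed.

HB.instance Definition _ :=
  GRing.SubChoice_isSubZmodule.Build _ _ cyc_lim threads_zmod_closed.

Let sub_cont : continuous (fun x : cyc_lim * cyc_lim => x.1 - x.2).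
Proof.
have coord_cont n : continuous (fun x : cyc_lim => val x n).
  move=> x; apply: (@continuous_comp _ _ _ (val : cyc_lim -> _) (proj n)).
    exact: initial_continuous.
  exact: proj_continuous.
apply: continuous_comp_initial => x; apply/cvg_sup => n.
apply: continuous_comp_initial x => x.
apply: (@continuous_comp _ _ _
  (fun x : cyc_lim * cyc_lim => (val x.1 n, val x.2 n))
  (fun y : cyc_sum k n * cyc_sum k n => y.1 - y.2)).
  apply: (@cvg_pair _ _ _ _ (nbhs (val x.1 n)) (nbhs (val x.2 n))).
    by apply: (@continuous_comp _ _ _ fst (fun x : cyc_lim => val x n));
      [exact: cvg_fst|exact: coord_cont].
  by apply: (@continuous_comp _ _ _ snd (fun x : cyc_lim => val x n));
    [exact: cvg_snd|exact: coord_cont].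
exact: sub_continuous.
Qed.

HB.instance Definition _ :=
  PreTopologicalNmodule_isTopologicalZmodule.Build cyc_lim sub_cont.

End Limit.

Arguments threads : clear implicits.

(* Main.v *)
(* Order C lexicographically, the first factor being the most significant. If
   [rank x n] is the number whose mixed-radix digits are the first n
   coordinates of x, this is the pointwise order of the sequences [rank x], and
   such sequences are exactly those with [rank x n = rank x n.+1 %/ radix n].
   Hence pointwise maxima and minima of ranks are again ranks: the order is
   complete, and at each level n the rank of a supremum or infimum is attained.
   It follows that between any x < y there is a jump a < b with nothing in
   between (cut at a rank separating x from y); the upper ends of jumps are
   compact, so the chain is algebraic, and the hypothesis is self-dual. Basic
   open sets of C are the sets of points of given rank at some level, and these
   are differences of a Scott open set and a principal filter or empty set. *)
Require Import Defs.
From HB Require Import structures.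
From mathcomp Require Import all_boot all_order all_algebra.
From mathcomp Require Import mathcomp_extra boolp classical_sets functions.
From mathcomp Require Import cardinality filter.
From mathcomp Require Import topology tvs.

Set Implicit Arguments.
Unset Strict Implicit.
Unset Printing Implicit Defensive.

Import Order.TTheory GRing.Theory.
Local Open Scope classical_set_scope.

(** * Compactness and algebraicity in chains with jumps *)

Section JumpDense.
Context {d : Order.disp_t} {T : orderType d}.
Local Open Scope order_scope.

Definition jump_dense : Prop := forall x y : T, x < y ->
  exists a b, [/\ x <= a, a < b, b <= y & forall z, z <= a \/ b <= z].

Lemma total_directed (S : set T) : S !=set0 -> directed S.
Proof.
move=> S0; split=> // x y Sx Sy; case: (leP x y) => [xy|/ltW yx].
  by exists y.
by exists x.
Qed.

(** A set with no member above [b] lies entirely below [a], so its supremum is at most [a]. *)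
Lemma upper_jump_compact (a b : T) :
  a < b -> (forall z, z <= a \/ b <= z) -> compact_elt b.
Proof.
move=> ab jump S s _ [_ s_le] bs; apply: contrapT => noS.
have : s <= a.
  by apply: s_le => t St; case: (jump t) => // bt; case: noS; exists t.
by move=> /(le_trans bs); rewrite leNgt ab.
Qed.

Lemma jump_dense_algebraic :
  jump_dense -> complete_lattice T -> algebraic T.
Proof.
move=> jump compl y; split.
  (* Directed sets are nonempty, so the bottom element is compact and the set in question is
     inhabited. *)
  have [_ [bot [bot_lb _]]] := compl setT.
  apply: total_directed; exists bot; split; first exact: bot_lb.
  by move=> S s [[t St] _] _ _; exists t => //; exact: bot_lb.
(* If an upper bound [u] were below [y], a jump between them would have a compact upper end [b]
   exceeding [u]. *)
split=> [x []//|u u_ub]; rewrite leNgt; apply/negP => /jump[a [b [ua ab b_y gap]]].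
have /le_trans/(_ ua) : b <= u.
  by apply: u_ub; split=> //; exact: upper_jump_compact gap.
by rewrite leNgt ab.
Qed.

End JumpDense.
Arguments jump_dense {d} T.

Lemma jump_dense_dual d (T : orderType d) : jump_dense T -> jump_dense T^d.
Proof.
move=> jump x y /jump[a [b [ya ab bx gap]]]; exists b, a; split=> // z.
by case: (gap z); [right|left].
Qed.

Lemma complete_lattice_dual d (T : porderType d) :
  complete_lattice T -> complete_lattice T^d.
Proof. by move=> compl S; have [? ?] := compl S. Qed.

Lemma jump_dense_bialgebraic d (T : orderType d) :
  jump_dense T -> complete_lattice T -> bialgebraic T.
Proof.
move=> jump compl; have compl' := complete_lattice_dual compl.
split; split=> //; first exact: jump_dense_algebraic.
by apply: jump_dense_algebraic => //; exact: jump_dense_dual.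
Qed.

(** * Mixed-radix ranks of threads *)

Section Rank.
Variable k : nat -> nat.
Implicit Types x y z : cyc_lim k.

(** This is by conversion the cardinality of the type 'Z_(k i), so digits are bounded by [ltn_ord]
    alone. *)
Definition radix i : nat := (Zp_trunc (k i)).+2.

Definition digit x i : nat := (val x i : cyc_sum k i) ord_max.

Fixpoint rank x n : nat :=
  if n is n'.+1 then (rank x n' * radix n' + digit x n')%N else 0%N.

Lemma rankS x n : rank x n.+1 = (rank x n * radix n + digit x n)%N.
Proof. by []. Qed.

Lemma digit_lt x i : (digit x i < radix i)%N.
Proof. exact: ltn_ord. Qed.

Lemma coordE x n (i : 'I_n.+1) : (val x n : cyc_sum k n) i = digit x i :> nat.
Proof.
have in_ : (i <= n)%N by rewrite -ltnS.
have /set_mem xT := valP x.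
rewrite /digit -(xT i n in_) ffunE.
by congr (nat_of_ord ((val x n : cyc_sum k n) _)); apply: val_inj.
Qed.

Lemma rank_div x n : (rank x n.+1 %/ radix n = rank x n)%N.
Proof. by rewrite /= divnMDl// divn_small ?addn0// digit_lt. Qed.

Lemma rank_mod x n : (rank x n.+1 %% radix n = digit x n)%N.
Proof. by rewrite /= modnMDl modn_small// digit_lt. Qed.

Lemma rank_bounded n : exists B, forall x, (rank x n <= B)%N.
Proof.
elim: n => [|n [B rankB]]; first by exists 0%N.
exists (B * radix n + radix n)%N => x /=.
by rewrite leq_add ?leq_mul// ltnW// digit_lt.
Qed.

Lemma eq_rank_le x y m n : (m <= n)%N -> rank x n = rank y n -> rank x m = rank y m.
Proof.
move=> /subnK <-; elim: (n - m)%N => // p IH; rewrite addSn => eqr.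
by apply: IH; rewrite -(rank_div x) -(rank_div y) eqr.
Qed.

(** Component [n] holds the digits 0 to [n], hence the shift to [n.+1]; the digits are recovered
    from the rank as remainders. *)
Lemma coord_eq_rank x y n : val x n = val y n <-> rank x n.+1 = rank y n.+1.
Proof.
split=> [eqv|eqr].
  have eqd i : (i <= n)%N -> digit x i = digit y i.
    rewrite -ltnS => ltin.
    by rewrite -(coordE x (Ordinal ltin)) -(coordE y (Ordinal ltin)) eqv.
  elim: n {eqv} eqd => [|n IH] eqd; first by rewrite /= eqd.
  by rewrite !(rankS _ n.+1) IH ?eqd// => i /leqW/eqd.
apply/ffunP => i; apply: val_inj.
apply: (etrans (coordE x i)); apply/esym/(etrans (coordE y i)).
by rewrite -!rank_mod (eq_rank_le _ eqr)// ltn_ord.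
Qed.

Lemma rank_inj x y : (forall n, rank x n = rank y n) -> x = y.
Proof.
move=> eqr; apply: val_inj; apply: functional_extensionality_dep => n.
exact/coord_eq_rank.
Qed.

Lemma rank_surj (R : nat -> nat) : R 0%N = 0%N ->
  (forall n, (R n.+1 %/ radix n = R n)%N) -> exists x, forall n, rank x n = R n.
Proof.
move=> R0 Rdiv.
(* [inZp] reduces modulo [radix i], which extracts the last digit of [R i.+1]. *)
pose f n : cyc_sum k n := [ffun i : 'I_n.+1 => inZp (R i.+1)].
have fT : (f : prod_topology _) \in threads k.
  by apply/mem_set => n m le_nm; apply/ffunP => i; rewrite !ffunE.
exists (exist (fun u : prod_topology _ => u \in threads k) f fT); elim=> [|n IH] //=.
by rewrite IH /digit ffunE /= [RHS](divn_eq _ (radix n)) Rdiv.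
Qed.

Lemma leq_rank x y m n : (m <= n)%N ->
  (rank x n <= rank y n)%N -> (rank x m <= rank y m)%N.
Proof.
move=> /subnK <-; elim: (n - m)%N => // p IH; rewrite addSn => ler.
by apply: IH; rewrite -(rank_div x) -(rank_div y) leq_div2r.
Qed.

Lemma rank_limit (t : nat -> cyc_lim k) :
  (forall n, rank (t n.+1) n = rank (t n) n) ->
  exists s, forall n, rank s n = rank (t n) n.
Proof. by move=> tS; apply: rank_surj => // n; rewrite rank_div. Qed.

(** * Rank cylinders as a neighbourhood base *)

Lemma coord_continuous n : continuous (fun x => val x n).
Proof.
move=> x; apply: (@continuous_comp _ _ _ (val : cyc_lim k -> _) (proj n)).
  exact: initial_continuous.
exact: proj_continuous.
Qed.

Lemma open_rank x n : open [set y | rank y n = rank x n].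
Proof.
case: n => [|n]; first by rewrite [X in open X](_ : _ = setT) ?predeqE//; exact: openT.
have -> : [set y | rank y n.+1 = rank x n.+1] =
    (fun y => val y n) @^-1` [set val x n].
  by apply/predeqP => y; split=> /coord_eq_rank.
move/continuousP: (@coord_continuous n); apply; exact: discrete_open.
Qed.

Lemma nbhs_rank x (U : set (cyc_lim k)) :
  nbhs x U -> exists n, [set y | rank y n = rank x n] `<=` U.
Proof.
pose cylinders : set_system (cyc_lim k) :=
  filter_from setT (fun n => [set y | rank y n = rank x n]).
have cylF : Filter cylinders.
  apply: filter_from_filter; first by exists 0%N.
  move=> m n _ _; exists (maxn m n) => // y /= eqr.
  by split; apply: eq_rank_le eqr; rewrite (leq_maxl, leq_maxr).
(* The topology is induced from the product, so convergence of the cylinder filter can be tested on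
   each component. *)
suff cvgx : (val @ cylinders) --> (val x).
  move=> /= [_ [[V oV <-]] Vx /= VU].
  have [|n _ nV] := cvgx V; first exact: open_nbhs_nbhs.
  by exists n => y /nV; exact: VU.
apply/cvg_sup => n V [_ [[W oW <-]] Wx /= WV].
exists n.+1 => // y /coord_eq_rank eqv; apply: WV.
by move: Wx; rewrite /= /proj eqv.
Qed.

End Rank.

(** A convertible alias that carries the order, while the topological group structure stays on
    [cyc_lim]. *)
Definition lex_lim (k : nat -> nat) : Type := cyc_lim k.

(** * The lexicographic order: totality, completeness, jumps *)

Section Lex.
Variable k : nat -> nat.
Notation L := (lex_lim k).
Implicit Types (x y z : L) (S U : set L).

HB.instance Definition _ := Choice.copy L (cyc_lim k).

Definition lex_le : rel L := fun x y => `[< forall n, (rank x n <= rank y n)%N >].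

Let lex_le_refl : reflexive lex_le.
Proof. by move=> x; apply/asboolP. Qed.

Let lex_le_anti : antisymmetric lex_le.
Proof.
move=> x y /andP[/asboolP xy /asboolP yx]; apply: rank_inj => n.
by apply/eqP; rewrite eqn_leq xy yx.
Qed.

Let lex_le_trans : transitive lex_le.
Proof.
move=> y x z /asboolP xy /asboolP yz; apply/asboolP => n.
exact: leq_trans (xy n) (yz n).
Qed.

HB.instance Definition _ :=
  Order.Le_isPOrder.Build Order.default_display L
    lex_le_refl lex_le_anti lex_le_trans.

Let lex_le_total : total (<=%O : rel L).
Proof.
move=> x y; have [//|/asboolP/existsNP[n /negP]] := boolP (x <= y)%O.
rewrite -ltnNge => yx; apply/asboolP => m.
(* Below level [n] the inequality passes to quotients; above it, a strict reversal would descend to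
   level [n]. *)
have [mn|/ltnW nm] := leqP m n; first exact: leq_rank mn (ltnW yx).
by rewrite leqNgt; apply: contraTN yx => /ltnW xy; rewrite -leqNgt (leq_rank nm).
Qed.

HB.instance Definition _ :=
  Order.POrder_isTotal.Build Order.default_display L lex_le_total.

Local Open Scope order_scope.

Lemma lex_leP x y : x <= y <-> forall n, (rank x n <= rank y n)%N.
Proof. by split=> /asboolP. Qed.

Lemma lex_ltP x y : x < y <-> exists n, (rank x n < rank y n)%N.
Proof.
rewrite ltNge; split=> [/negP|[n xy]].
  by move/lex_leP/existsNP => [n /negP]; rewrite -ltnNge; exists n.
by apply/negP => /lex_leP/(_ n); rewrite leqNgt xy.
Qed.

Lemma sup_rank S : S !=set0 ->
  exists2 s, supremums S s & forall n, exists2 t, S t & rank s n = rank t n.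
Proof.
move=> [x0 Sx0].
have max_rank n : exists t, S t /\ forall x, S x -> (rank x n <= rank t n)%N.
  pose p i := `[< exists2 x, S x & rank x n = i >].
  have [B rankB] := rank_bounded k n.
  have p0 : exists i, p i by exists (rank x0 n); apply/asboolP; exists x0.
  have pB i : p i -> (i <= B)%N by move=> /asboolP[x _ <-].
  case: (ex_maxnP p0 pB) => _ /asboolP[t St <-] t_max.
  by exists t; split=> // x Sx; apply: t_max; apply/asboolP; exists x.
have [t] := choice max_rank.
move=> /all_and2[St t_max].
(* Division by the radix is monotone, so [t n.+1] has maximal rank at level [n] as well and the
   maxima are compatible. *)
have [n|s rank_s] := @rank_limit k t.
  apply/eqP; rewrite eqn_leq t_max//=.
  by rewrite (leq_rank (leqnSn n))// t_max.
exists s; last by move=> n; exists (t n).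
split=> [x Sx|u Su]; apply/lex_leP => n; rewrite rank_s; first exact: t_max.
by have /lex_leP := Su _ (St n).
Qed.

Lemma inf_rank S : S !=set0 ->
  exists2 s, infimums S s & forall n, exists2 t, S t & rank s n = rank t n.
Proof.
move=> [x0 Sx0].
have min_rank n : exists t, S t /\ forall x, S x -> (rank t n <= rank x n)%N.
  pose p i := `[< exists2 x, S x & rank x n = i >].
  have p0 : exists i, p i by exists (rank x0 n); apply/asboolP; exists x0.
  case: (ex_minnP p0) => _ /asboolP[t St <-] t_min.
  by exists t; split=> // x Sx; apply: t_min; apply/asboolP; exists x.
have [t] := choice min_rank.
move=> /all_and2[St t_min].
have [n|s rank_s] := @rank_limit k t.
  apply/eqP; rewrite eqn_leq t_min//= andbT.
  by rewrite (leq_rank (leqnSn n))// t_min.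
exists s; last by move=> n; exists (t n).
split=> [x Sx|u Su]; apply/lex_leP => n; rewrite rank_s; first exact: t_min.
by have /lex_leP := Su _ (St n).
Qed.

Lemma lex_complete : complete_lattice L.
Proof.
have inh : [set: L] !=set0 by exists (0%R : cyc_lim k).
move=> S; have [->|/set0P S0] := eqVneq S set0; last first.
  by split; [case: (sup_rank S0)|case: (inf_rank S0)] => s; exists s.
(* For the empty set, the supremum is the bottom element and the infimum is the top. *)
have [b [b_lb _] _] := inf_rank inh; have [t [t_ub _] _] := sup_rank inh.
split; [exists b|exists t]; split=> // x _; [exact: b_lb|exact: t_ub].
Qed.

Lemma lex_jump_dense : jump_dense L.
Proof.
move=> x y /lex_ltP[n xy].
have [a [a_ub _] /(_ n)[a' a'y ra]] := @sup_rank [set z | (rank z n < rank y n)%N]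
  (ex_intro _ x xy).
have [b [b_lb _] /(_ n)[b' yb' rb]] := @inf_rank [set z | (rank y n <= rank z n)%N]
  (ex_intro _ y (leqnn _)).
exists a, b; split; [exact: a_ub| |exact/b_lb/leqnn|].
  (* Strictness holds because both bounds have their rank at level [n] attained, on opposite sides
     of the cut. *)
  by apply/lex_ltP; exists n; rewrite ra rb; exact: leq_trans yb'.
move=> z; have [yz|zy] := leqP (rank y n) (rank z n).
  by right; exact: b_lb.
by left; exact: a_ub.
Qed.

(** * Comparison of the Lawson and limit topologies *)

Lemma scott_open_rank x n : scott_open [set z : L | (rank x n <= rank z n)%N].
Proof.
split.
  apply/seteqP; split=> [z xz|z [y /= xy /lex_leP yz]]; first by exists z => /=.
  exact: leq_trans xy (yz n).
(* Some member of [S] already has the rank of the supremum at level [n]. *)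
move=> S s [S0 _] s_sup /= xs; have [s' s'_sup /(_ n)[t St rt]] := sup_rank S0.
by exists t; split=> //=; rewrite -rt (is_subset1_supremums s'_sup s_sup).
Qed.

Lemma lawson_basis_rank x n : lawson_basis L [set z | rank z n = rank x n].
Proof.
(* The part of higher rank is the principal filter of its least element [b]; if it is empty, nothing
   need be removed. *)
have [above|noabove] := pselect ([set z : L | (rank x n < rank z n)%N] !=set0).
  have [b [b_lb _] /(_ n)[b' xb' rb]] := inf_rank above.
  exists [set z | (rank x n <= rank z n)%N], [set b].
  split; [exact: scott_open_rank|exact: finite_set1|].
  apply/predeqP => z /=; split=> [zx|[xz bz]].
    split; first by rewrite /= zx.
    by move=> [_ -> /lex_leP/(_ n)]; rewrite rb zx leqNgt xb'.
  apply/eqP; rewrite eqn_leq xz andbT leqNgt; apply/negP => zx.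
  by apply: bz; exists b => //; exact: b_lb.
exists [set z | (rank x n <= rank z n)%N], set0.
split; [exact: scott_open_rank|exact: finite_set0|].
apply/predeqP => z /=; split=> [zx|[xz _]].
  by split; [rewrite /= zx|case].
apply/eqP; rewrite eqn_leq xz andbT leqNgt; apply/negP => zx.
by apply: noabove; exists z.
Qed.

(** The point [x] is the directed supremum of the minima of its cylinders. One minimum falls in [U],
    and the upper set [U] then contains that whole cylinder. *)
Lemma scott_open_open U : scott_open U -> open (U : set (cyc_lim k)).
Proof.
move=> [Uup Uscott]; rewrite openE => x Ux.
have cyl_inf n := @inf_rank [set z : L | rank z n = rank x n] (ex_intro _ x erefl).
pose S : set L := [set z | exists n, infimums [set y : L | rank y n = rank x n] z].
have Sdir : directed S.
  by apply: total_directed; have [s s_inf _] := cyl_inf 0%N; exists s, 0%N.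
have Ssup : supremums S (x : L).
  split=> [z [n [z_lb _]]|u u_ub]; first exact: z_lb.
  apply/lex_leP => n; have [z z_inf /(_ n)[t tx rz]] := cyl_inf n.
  by have /lex_leP/(_ n) := u_ub z (ex_intro _ n z_inf); rewrite rz tx.
have [z [[n [z_lb _]] Uz]] := Uscott S x Sdir Ssup Ux.
apply: (@filterS _ _ _ [set y | rank y n = rank x n]).
  by move=> y yx; rewrite Uup; exists z => //; exact: z_lb.
exact: open_nbhs_nbhs (conj (open_rank x n) erefl).
Qed.

(** Being strictly below [x] is witnessed by the rank at a single level, hence shared by a whole
    cylinder. *)
Lemma closed_up x : closed ([set y | x <= y] : set (cyc_lim k)).
Proof.
rewrite -openC openE => y /negP; rewrite -ltNge => /lex_ltP[n yx].
apply: (@filterS _ _ _ [set z | rank z n = rank y n]).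
  by move=> z zy /lex_leP/(_ n); rewrite zy leqNgt yx.
exact: open_nbhs_nbhs (conj (open_rank y n) erefl).
Qed.

Lemma lex_lawson : lawson_open L = @open (cyc_lim k).
Proof.
apply/predeqP => U; split=> [[B BL <-]|oU].
  apply: bigcup_open => _ /BL[V [F [oV finF ->]]].
  (* [lawson_basis] is stated with the difference of the order on sets. *)
  rewrite -[X in open X]/(V `\` upset F)%classic setDE.
  apply: openI; first exact: scott_open_open.
  by rewrite openC; apply: closed_bigcup => // x _; exact: closed_up.
exists [set W | lawson_basis L W /\ W `<=` U]; first by move=> W [].
apply/predeqP => x; split=> [[W [_ WU] /WU//]|Ux].
have [n nU] := nbhs_rank (open_nbhs_nbhs (conj oU Ux)).
by exists [set y | rank y n = rank x n] => //; split=> //; exact: lawson_basis_rank.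
Qed.

End Lex.

Theorem theorem5 (k : nat -> nat) (k_gt1 : forall i : nat, (1 < k i)%N) :
  exists (d : Order.disp_t) (o : Order.Total d (cyc_lim k)),
    let L : orderType d := Order.Total.Pack o in
    [/\ complete_lattice L,
        bialgebraic L &
        (lawson_open L : set (set (cyc_lim k))) = @open (cyc_lim k)].
Proof.
exists Order.default_display, (Order.Total.class (lex_lim k)).
have compl := @lex_complete k; split; [exact: compl| |exact: lex_lawson].
exact: (jump_dense_bialgebraic (@lex_jump_dense k)).
Qed.
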